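(* Let $T$ be a tree with $n$ vertices and $l$ leaves. If $T$ is $e$-positive, then it has at least \[ \sum_{k = \lceil \frac{n}{2} \rceil}^{n-2} k(n-k) + \frac{(2l-n)(n-1)}{2} \] acyclic orientations with $2$ sinks.
   Context: Chromatic symmetric function: for a graph $G$ with vertices $v_1,\dots,v_d$, $X_G=\sum_\kappa x_{\kappa(v_1)}\cdots x_{\kappa(v_d)}$, the sum over all proper colorings $\kappa:V(G)\to\{1,2,\dots\}$ (i.e., $\kappa(u)\neq\kappa(v)$ for every edge $uv$). For an integer partition $\lambda=(\lambda_1,\dots,\lambda_\ell)$, $e_\lambda=e_{\lambda_1}\cdots e_{\lambda_\ell}$ with $e_k=\sum_{1\le j_1<\cdots<j_k}x_{j_1}\cdots x_{j_k}$. A graph $G$ is $e$-positive if all coefficients of $X_G$ in the basis $\{e_\lambda\}$ are non-negative. An acyclic orientation of a graph is an orientation of its edges with no directed cycle; a sink is a vertex with no arcs pointing out of it. A leaf is a vertex of degree $1$.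
   Formalization: The case n = 2 is excluded: for the single edge, X = 2e_2 is e-positive and the bound equals 1, but it has no acyclic orientation with 2 sinks. *)

(* Defs.v *)
From HB Require Import structures.
From mathcomp Require Import all_boot all_order all_algebra finmap.
From mathcomp.multinomials Require Import monalg.

Set Implicit Arguments.
Unset Strict Implicit.
Unset Printing Implicit Defensive.

Import Order.TTheory GRing.Theory Num.Theory.

Local Open Scope ring_scope.

(** * Formal power series in countably many variables x_0, x_1, x_2, ...

    A monomial is an element of [{cmonom nat}]; a power series with rational
    coefficients is its coefficient function.  The colours 1, 2, 3, ... are
    represented by 0, 1, 2, ... *)

Definition series := {cmonom nat} -> rat.

Definition mon_prod (I : finType) (P : pred I) (F : I -> nat) : {cmonom nat} :=
  \big[mmul/mone]_(i | P i) ucm (F i).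

(* A divisor of m assigns to each variable i of m an exponent in {0, .., m i}. *)
Definition mon_divisors (m : {cmonom nat}) : seq {cmonom nat} :=
  [seq [cmonom (val (a i) : nat) | i : finsupp m]%M
     | a : {dffun forall i : finsupp m, 'I_(m (val i)).+1}].

Lemma mon_divisorsE (m : {cmonom nat})
    (a : {dffun forall i : finsupp m, 'I_(m (val i)).+1}) (i : finsupp m) :
  [cmonom (val (a i) : nat) | i : finsupp m]%M (val i) = a i.
Proof.
rewrite cmE fsfun_ffun; case: insubP => [u _ /val_inj ->//|].
by rewrite fsvalP.
Qed.

Lemma mem_mon_divisors (m d : {cmonom nat}) :
  reflect (forall i, (d i <= m i)%N) (d \in mon_divisors m).
Proof.
apply: (iffP imageP) => [[a _ ->] i|le_dm].
  rewrite cmE fsfun_ffun; case: insubP => [u _ <-|//].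
  by rewrite -ltnS ltn_ord.
exists [ffun i : finsupp m => (inord (d (val i)) : 'I_(m (val i)).+1)] => //.
apply/eqP/cmP => i; have [im|] := boolP (i \in finsupp m).
  by rewrite (mon_divisorsE _ [` im]%fset) ffunE inordK ?ltnS.
move=> im; rewrite cmE fsfun_ffun insubN //; move: im.
by rewrite -cmE_eq0 => /eqP mi0; apply/eqP; move: (le_dm i); rewrite mi0 leqn0.
Qed.

Lemma uniq_mon_divisors (m : {cmonom nat}) : uniq (mon_divisors m).
Proof.
rewrite map_inj_uniq ?enum_uniq // => a b /eqP/cmP eq_ab.
apply/ffunP => i; apply/val_inj; move: (eq_ab (val i)).
by rewrite !mon_divisorsE.
Qed.

Definition series_one : series := fun m => (m == mone)%:R.

Definition series_mul (f g : series) : series :=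
  fun m => \sum_(d <- mon_divisors m) f d * g (divcm m d).

(** * Elementary symmetric functions *)

(* The coefficient of m is the number of k-element sets J of indices such that
   m is the product of the x_j, j in J; all such J lie in the support of m. *)
Definition esym (k : nat) : series :=
  fun m => #|[set J : {set finsupp m} | (#|J| == k)
                 && (mon_prod (mem J) val == m)]|%:R.

Definition is_partition (la : seq nat) : bool := sorted geq la && (0%N \notin la).

Definition esym_part (la : seq nat) : series :=
  foldr (fun k f => series_mul (esym k) f) series_one la.

(** * Graphs: a finite simple graph is a symmetric irreflexive relation *)

Definition simple_graph (V : finType) (e : rel V) : Prop :=
  symmetric e /\ irreflexive e.

(* A cycle of a simple graph is a closed path without repeated vertices and of
   length at least 3. *)
Definition is_tree (V : finType) (e : rel V) : Prop :=
  [/\ simple_graph e,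
      (0 < #|V|)%N,
      (forall x y : V, connect e x y)
    & (forall c : seq V, (2 < size c)%N -> ~ ucycle e c)].

Definition leaves (V : finType) (e : rel V) : {set V} :=
  [set v | #|[set w | e v w]| == 1%N].

(** * Chromatic symmetric function *)

Definition proper (V : finType) (e : rel V) (C : eqType) (kappa : V -> C) : bool :=
  [forall u, forall v, e u v ==> (kappa u != kappa v)].

(* The coefficient of m is the number of proper colourings whose monomial is m;
   all such colourings take their values in the support of m. *)
Definition chromatic_sym (V : finType) (e : rel V) : series :=
  fun m => #|[set kappa : {ffun V -> finsupp m} |
                 proper e kappa
                 && (mon_prod predT (fun v => val (kappa v)) == m)]|%:R.

(* [c la] is the coefficient of e_la in the e-expansion of X_G, and [s] lists
   the partitions that occur in it. *)
Definition e_positive (V : finType) (e : rel V) : Prop :=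
  exists (s : seq (seq nat)) (c : seq nat -> rat),
    [/\ uniq s, all is_partition s,
        (forall m, chromatic_sym e m = \sum_(la <- s) c la * esym_part la m)
      & (forall la, la \in s -> 0 <= c la)].

(** * Orientations: [(x, y) \in o] is the arc from x to y *)

Definition is_orientation (V : finType) (e : rel V) (o : {set V * V}) : bool :=
  [forall x, forall y,
     if e x y then ((x, y) \in o) (+) ((y, x) \in o) else (x, y) \notin o].

(* A directed cycle is an arc from x to y closed by a directed path from y
   back to x. *)
Definition acyclic (V : finType) (o : {set V * V}) : bool :=
  ~~ [exists x, exists y,
        ((x, y) \in o) && connect (fun u v => (u, v) \in o) y x].

Definition sinks (V : finType) (o : {set V * V}) : {set V} :=
  [set x | [forall y, (x, y) \notin o]].

Definition acyclic_orientations_with_sinks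
    (V : finType) (e : rel V) (j : nat) : {set {set V * V}} :=
  [set o | [&& is_orientation e o, acyclic o & #|sinks o| == j]].

(* Main.v *)
Require Import Defs.
From mathcomp Require Import all_boot all_order all_algebra all_field finmap.
From mathcomp.multinomials Require Import monalg.
From mathcomp Require Import zify ring lra.

(** Deleting an edge xy of a tree on n vertices leaves two branches, of sizes s
    and n - s.  The number of acyclic orientations with two sinks is at least
    the sum of s (n - s) over the edges, minus n (n - 1) / 2.  To see this, take
    a vertex p and two vertices a, b in different components of T - p.  There is
    an orientation whose only sinks are a and b, in which p is the source of the
    path from a to b and every edge off the path points to the path; it
    determines p and {a, b} ([card_separates_le]).  Counting the ordered triples
    (p, a, b) by complement, through the pairs (a, b) that lie in one component
    of T - p, gives twice the claimed number ([wiener_sum]).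

    If n > 2, each of the l leaf edges contributes n - 1 to the sum.  The bound follows if
    for each k with n/2 <= k <= n - 2 some edge has branch sizes k and n - k
    ([wiener_ge]), and this is where e-positivity enters ([e_positive_branch]).
    Write n = a + b with 0 < b <= a, and evaluate the expansion
    X_T = sum of c_la e_la at roots of unity; in degree n and finitely many
    variables it is an identity between polynomials.

    - At the negatives of the n-th roots of unity, the generating function of
      the e_k is X^n - 1, so every e_la of degree n vanishes except e_n.  On the
      other side, inclusion-exclusion over the edges leaves only the constant
      colourings, and X_T does not vanish ([chromatic_root_neq0]).  Hence c_n is
      nonzero.

    - At the negatives of the a-th roots of unity together with t times the
      negatives of the b-th roots of unity, take the coefficient of t^b.  It is 1
      for e_n and nonnegative for every e_la ([block_coef_ge0]).  If no edge has
      branch sizes a and b, it is 0 for X_T ([chromatic_blocks_coef0]): for each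
      choice of the b vertices coloured in the second block, one of the two
      sides is disconnected, and rotating the colours of one of its components
      multiplies the sum by a root of unity other than 1.  All terms
      c_la [t^b] e_la are nonnegative and sum to 0, so c_n = 0, a contradiction.

    Both evaluations isolate a power sum coefficient of X_T, those of p_n and of
    p_a p_b.  For a tree, the latter counts the edges with branch sizes a and b
    up to a nonzero factor. *)

Set Implicit Arguments.
Unset Strict Implicit.
Unset Printing Implicit Defensive.

Import Order.TTheory GRing.Theory Num.Theory.

Local Open Scope ring_scope.

(* The names esym and proper are also those of an unrelated lemma and of an
   unrelated relation on finite sets. *)
Local Notation elem_sym := Defs.esym.
Local Notation proper := Defs.proper.

(** * Evaluating power series in finitely many variables *)

Lemma le_mdeg (m : {cmonom nat}) i : (m i <= mdeg m)%N.
Proof.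
rewrite mdegE; case: mdomP => [i_m|//].
by rewrite (big_fsetD1 i) //= leq_addr.
Qed.

Lemma mon_prodE (I : finType) (P : pred I) (F : I -> nat) j :
  mon_prod P F j = (\sum_(i | P i) (F i == j))%N.
Proof.
rewrite /mon_prod (@big_morph _ _ (fun m : {cmonom nat} => m j) 0%N addn) //.
- by apply: eq_bigr => i _; rewrite cmU.
- by move=> m1 m2 /=; rewrite cmM.
- exact: cm1.
Qed.

Lemma mdeg_mon_prod (I : finType) (P : pred I) (F : I -> nat) :
  mdeg (mon_prod P F) = #|P|.
Proof.
rewrite mdeg_prod -sum1_card.
by apply: eq_bigr => i _; rewrite mdegU.
Qed.

Lemma mon_prod_supp (I : finType) (P : pred I) (F : I -> nat) i :
  P i -> F i \in finsupp (mon_prod P F).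
Proof.
by move=> Pi; rewrite -cmE_neq0 mon_prodE (bigD1 i) //= eqxx.
Qed.

Definition homogeneous (p : nat) (f : series) : Prop :=
  forall m, mdeg m != p -> f m = 0.

Lemma divcmK (m d : {cmonom nat}) : (forall i, (d i <= m i)%N) ->
  mmul d (divcm m d) = m.
Proof.
by move=> le_dm; apply/eqP/cmP => i; rewrite cmM divcmE subnKC.
Qed.

Lemma mulcm_divK (d m : {cmonom nat}) : divcm (mmul d m) d = m.
Proof. by apply/eqP/cmP => i; rewrite divcmE cmM addKn. Qed.

Lemma homogeneous_one : homogeneous 0 series_one.
Proof. by move=> m; rewrite mdeg_eq0 /series_one => /negbTE ->. Qed.

Lemma homogeneous_mul p q f g : homogeneous p f -> homogeneous q g ->
  homogeneous (p + q) (series_mul f g).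
Proof.
move=> hf hg m deg_m; rewrite /series_mul big_seq big1 // => d.
move/mem_mon_divisors/divcmK => dvd_dm.
have [deg_d|/hf->] := eqVneq (mdeg d) p; last by rewrite mul0r.
rewrite [g _]hg ?mulr0 //; apply: contraNneq deg_m => deg_md.
by rewrite -dvd_dm mdegM deg_d deg_md.
Qed.

Lemma homogeneous_esym k : homogeneous k (elem_sym k).
Proof.
move=> m deg_m; rewrite /Defs.esym; apply/eqP; rewrite pnatr_eq0 cards_eq0.
apply/eqP/setP => J; rewrite !inE; apply/negP => /andP[/eqP cJ /eqP mJ].
by move: deg_m; rewrite -mJ mdeg_mon_prod cJ eqxx.
Qed.

Lemma homogeneous_esym_part la : homogeneous (sumn la) (esym_part la).
Proof.
elim: la => [|k la IHla] /=; first exact: homogeneous_one.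
by apply: homogeneous_mul IHla; apply: homogeneous_esym.
Qed.

Section Evaluation.

Variables (R : comNzRingType) (phi : {rmorphism rat -> R}).
Variables (N : nat) (x : 'I_N -> R).

Definition monomials (p : nat) : seq {cmonom nat} :=
  [seq m <- mon_divisors (mon_prod predT (fun k : 'I_N * 'I_p => val k.1))
     | mdeg m == p].

(** The degree bounds every exponent, so cutting the divisors of (x_0 ... x_(N-1))^p
    down to degree p loses no monomial of degree p. *)
Lemma mem_monomials p m :
  (m \in monomials p)
    = (mdeg m == p) && all (fun i => i < N)%N (enum_fset (finsupp m)).
Proof.
rewrite mem_filter; case: eqP => //= deg_m.
have boxE i : mon_prod predT (fun k : 'I_N * 'I_p => val k.1) i
              = ((i < N)%N * p)%N.
  rewrite mon_prodE -(pair_bigA _ (fun (j : 'I_N) (_ : 'I_p) => (val j == i) : nat)) /=.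
  under eq_bigr do rewrite sum_nat_const card_ord.
  rewrite -big_distrr /= mulnC; congr (_ * _)%N.
  have [lt_iN|le_Ni] := ltnP i N.
    rewrite (bigD1 (Ordinal lt_iN)) //= eqxx big1 ?addn0 // => j ne_j.
    by apply/eqP; rewrite eqb0; apply: contra ne_j => /eqP eq_ji; apply/eqP/val_inj.
  by rewrite big1 // => j _; apply/eqP; rewrite eqb0 neq_ltn (leq_trans (ltn_ord j)).
apply/mem_mon_divisors/allP => /= [le_m i im|lt_m i].
  by move: im (le_m i); rewrite -cmE_neq0 boxE; case: (i < N)%N => //;
    rewrite mul0n leqn0 => /negbTE ->.
rewrite boxE; case: mdomP => [im|//].
by rewrite (lt_m i im) mul1n -deg_m le_mdeg.
Qed.

Lemma uniq_monomials p : uniq (monomials p).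
Proof. exact/filter_uniq/uniq_mon_divisors. Qed.

Lemma mem_monomialsM p q (d m : {cmonom nat}) : mdeg d = p ->
  (mmul d m \in monomials (p + q))
    = (d \in monomials p) && (m \in monomials q).
Proof.
move=> deg_d; rewrite !mem_monomials mdegM deg_d eqn_add2l eqxx /=.
rewrite andbCA; congr (_ && _); apply/allP/andP => [lt_dm|[/allP lt_d /allP lt_m] i].
  by split; apply/allP => i im; apply: lt_dm; rewrite mdomD in_fsetU im ?orbT.
by rewrite mdomD in_fsetU => /orP[/lt_d|/lt_m].
Qed.

Lemma mem_mon_prod (I : finType) (P : pred I) (F : I -> 'I_N) :
  mon_prod P (fun i => val (F i)) \in monomials #|P|.
Proof.
rewrite mem_monomials mdeg_mon_prod eqxx; apply/allP => /= j.
rewrite -cmE_neq0 mon_prodE sum_nat_eq0 => /forallPn /= [i].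
by rewrite negb_imply eqb0 negbK => /andP[_ /eqP <-].
Qed.

Definition mon_eval (m : {cmonom nat}) : R := \prod_(i < N) x i ^+ m i.

Lemma mon_evalM d m : mon_eval (mmul d m) = mon_eval d * mon_eval m.
Proof. by rewrite -big_split; apply: eq_bigr => i _; rewrite cmM exprD. Qed.

Lemma mon_eval_prod (I : finType) (P : pred I) (F : I -> 'I_N) :
  mon_eval (mon_prod P (fun i => val (F i))) = \prod_(i | P i) x (F i).
Proof.
rewrite /mon_prod (big_morph _ mon_evalM (id1 := 1)); last first.
  by apply: big1 => i _; rewrite cm1.
apply: eq_bigr => i _; rewrite /mon_eval (bigD1 (F i)) //= cmUU expr1.
rewrite big1 ?mulr1 // => j ne_j; rewrite cmU.
by rewrite val_eqE eq_sym (negbTE ne_j).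
Qed.

(** The value at x_i, for i < N, and 0 for the other variables, of the
    homogeneous component of degree p; fixing p makes the sum finite. *)
Definition series_eval (p : nat) (f : series) : R :=
  \sum_(m <- monomials p) phi (f m) * mon_eval m.

Lemma eq_series_eval p f g : f =1 g -> series_eval p f = series_eval p g.
Proof. by move=> eq_fg; apply: eq_bigr => m _; rewrite eq_fg. Qed.

Lemma series_eval_sum p (I : eqType) (s : seq I) (c : I -> rat) (f : I -> series) :
  series_eval p (fun m => \sum_(i <- s) c i * f i m)
  = \sum_(i <- s) phi (c i) * series_eval p (f i).
Proof.
rewrite /series_eval; under [RHS]eq_bigr do rewrite big_distrr.
rewrite exchange_big; apply: eq_bigr => m _.
by rewrite rmorph_sum big_distrl; apply: eq_bigr => i _ /=; rewrite rmorphM mulrA.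
Qed.

Lemma series_eval_homogeneous p q f : homogeneous q f -> p != q ->
  series_eval p f = 0.
Proof.
move=> hf ne_pq; rewrite /series_eval big_seq big1 // => m.
rewrite mem_filter => /andP[/eqP deg_m _].
by rewrite hf ?deg_m // rmorph0 mul0r.
Qed.

Lemma series_eval_one : series_eval 0 series_one = 1.
Proof.
rewrite /series_eval (bigD1_seq mone) ?uniq_monomials //=; last first.
  by rewrite mem_monomials mdeg1 eqxx mdom1.
rewrite big1_seq ?addr0 => [|m /andP[ne_m1 _]].
  rewrite /series_one eqxx rmorph1 mul1r.
  by apply: big1 => i _; rewrite cm1.
by rewrite /series_one (negbTE ne_m1) rmorph0 mul0r.
Qed.

(** Factorisations m = d m' with d of degree p correspond to pairs (d, m') in
    which both degrees are prescribed; divisors d of any other degree contribute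
    nothing to the product because f is homogeneous. *)
Lemma series_eval_mul p q f g : homogeneous p f ->
  series_eval (p + q) (series_mul f g) = series_eval p f * series_eval q g.
Proof.
move=> hf; pose F (u : {cmonom nat} * {cmonom nat}) :=
  phi (f u.1) * mon_eval u.1 * (phi (g u.2) * mon_eval u.2).
transitivity (\sum_(u <- [seq (d, divcm m d) | m <- monomials (p + q),
    d <- [seq d <- mon_divisors m | mdeg d == p]]) F u).
  rewrite big_allpairs_dep /= /series_eval big_seq [RHS]big_seq.
  apply: eq_bigr => m _.
  rewrite /series_mul rmorph_sum big_distrl big_filter /= big_mkcond /=.
  rewrite [RHS]big_mkcond big_seq [RHS]big_seq; apply: eq_bigr => d.
  move/mem_mon_divisors/divcmK => dvd_dm.
  case: eqP => [_|/eqP/hf->]; last by rewrite mul0r rmorph0 mul0r.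
  rewrite /F /= -[X in mon_eval X]dvd_dm mon_evalM rmorphM mulrACA.
  by rewrite !mulrA.
rewrite /series_eval big_distrl /=; under [RHS]eq_bigr do rewrite big_distrr /=.
have -> : \sum_(d <- monomials p) \sum_(m <- monomials q)
    phi (f d) * mon_eval d * (phi (g m) * mon_eval m)
  = \sum_(u <- [seq (d, m) | d <- monomials p, m <- monomials q]) F u.
  by rewrite big_allpairs_dep.
apply: perm_big; apply: uniq_perm.
- rewrite allpairs_uniq_dep ?uniq_monomials // => [m _|].
    exact/filter_uniq/uniq_mon_divisors.
  move=> _ _ /allpairsPdep[m [d [_ md ->]]] /allpairsPdep[m' [d' [_ md' ->]]] /=.
  move: md md'; rewrite !mem_filter.
  move=> /andP[_ /mem_mon_divisors/divcmK Em] /andP[_ /mem_mon_divisors/divcmK Em'].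
  by case=> Ed Edm; rewrite -[m]Em -[m' in RHS]Em' Edm Ed.
- rewrite allpairs_uniq_dep ?uniq_monomials //.
  by move=> _ _ /allpairsPdep[m [d [_ _ ->]]] /allpairsPdep[m' [d' [_ _ ->]]] [-> ->].
move=> [d m]; apply/allpairsPdep/allpairsPdep => /=.
  move=> [m' [d' [mm' + [-> ->]]]]; rewrite mem_filter => /andP[/eqP deg_d].
  move=> /mem_mon_divisors/divcmK dvd_d; move: mm'.
  by rewrite -{1}dvd_d mem_monomialsM // => /andP[? ?]; exists d', (divcm m' d').
move=> [d' [m' [md' mm' [-> ->]]]]; exists (mmul d' m'), d'.
have deg_d: mdeg d' = p by move: md'; rewrite mem_filter => /andP[/eqP].
split; rewrite ?mulcm_divK ?mem_monomialsM ?md' // mem_filter deg_d eqxx.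
by apply/mem_mon_divisors => i; rewrite cmM leq_addr.
Qed.

Lemma series_eval_esym_part la :
  series_eval (sumn la) (esym_part la)
    = \prod_(k <- la) series_eval k (elem_sym k).
Proof.
elim: la => [|k la IHla] /=; first by rewrite big_nil series_eval_one.
by rewrite series_eval_mul ?IHla ?big_cons //; apply: homogeneous_esym.
Qed.

Lemma supp_in_range p (m : {cmonom nat}) (u : finsupp m) :
  m \in monomials p -> (val u < N)%N.
Proof. by rewrite mem_monomials => /andP[_ /allP]; apply; apply: fsvalP. Qed.

(** A series whose coefficients count objects by weight evaluates to the sum of
    the weights of the objects. *)
Lemma sum_mon_eval (I : finType) (Q : pred I) (F : I -> {cmonom nat}) p :
    (forall i, Q i -> F i \in monomials p) ->
  \sum_(m <- monomials p) #|[set i | Q i && (F i == m)]|%:R * mon_eval m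
    = \sum_(i | Q i) mon_eval (F i).
Proof.
move=> memF; transitivity (\sum_(m <- monomials p) \sum_(i | Q i)
    if F i == m then mon_eval m else 0).
  apply: eq_bigr => m _; rewrite -sum1_card natr_sum big_distrl /=.
  rewrite -big_mkcondr; apply: eq_big => [i|i _]; first by rewrite inE.
  by rewrite mul1r.
rewrite exchange_big; apply: eq_bigr => i Qi.
rewrite (bigD1_seq (F i)) ?uniq_monomials ?memF //= eqxx big1 ?addr0 // => m.
by rewrite eq_sym => /negbTE ->.
Qed.

Lemma series_eval_esym k :
  series_eval k (elem_sym k) = \sum_(J : {set 'I_N} | #|J| == k) \prod_(j in J) x j.
Proof.
under [RHS]eq_bigr do rewrite -mon_eval_prod.
rewrite -(@sum_mon_eval _ _ _ k) => [|J /eqP <-]; last exact: mem_mon_prod.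
rewrite /series_eval big_seq [RHS]big_seq; apply: eq_bigr => m m_in.
rewrite /Defs.esym rmorph_nat; congr (_%:R * _).
(* The coefficient of m counts subsets of the support of m, the right-hand side
   subsets of 'I_N; h identifies the former among the latter. *)
pose h u := Ordinal (supp_in_range u m_in).
have h_inj : injective h by move=> u v [] /val_inj.
rewrite -(card_imset _ (imset_inj h_inj)); congr #|pred_of_set _|.
apply/setP => J; rewrite inE; apply/imsetP/andP => [[K + ->]|[cJ /eqP mJ]].
  rewrite inE card_imset // => /andP[-> /eqP mK]; split=> //; apply/eqP.
  rewrite -[RHS]mK /mon_prod.
  by rewrite big_imset //=; move=> ? ? _ _; apply: h_inj.
have J_supp j : j \in J -> val j \in finsupp m.
  by move=> jJ; rewrite -mJ; apply: (@mon_prod_supp _ (mem J) val).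
have EJ : J = h @: (h @^-1: J).
  apply/setP => j; apply/idP/imsetP => [jJ|[u + ->]]; last by rewrite inE.
  have Ej : h [` J_supp j jJ]%fset = j by apply/val_inj.
  by exists [` J_supp j jJ]%fset; rewrite ?inE Ej.
exists (h @^-1: J) => //; rewrite inE; apply/andP; split.
  by rewrite -(card_imset _ h_inj) -EJ.
by apply/eqP; rewrite -[RHS]mJ {2}EJ /mon_prod big_imset //= => ? ? _ _; apply: h_inj.
Qed.

Lemma series_eval_chromatic (V : finType) (e : rel V) :
  series_eval #|V| (chromatic_sym e)
    = \sum_(kappa : {ffun V -> 'I_N} | proper e kappa) \prod_v x (kappa v).
Proof.
under [RHS]eq_bigr do rewrite -mon_eval_prod.
rewrite -(@sum_mon_eval _ _ _ #|V|) => [|kappa _]; last exact: mem_mon_prod.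
rewrite /series_eval big_seq [RHS]big_seq; apply: eq_bigr => m m_in.
rewrite /chromatic_sym rmorph_nat; congr (_%:R * _).
pose h u := Ordinal (supp_in_range u m_in).
have h_inj : injective h by move=> u v [] /val_inj.
pose H (kappa : {ffun V -> finsupp m}) := [ffun v => h (kappa v)].
have H_inj : injective H.
  by move=> k1 k2 /ffunP eqk; apply/ffunP => v; move: (eqk v); rewrite !ffunE => /h_inj.
rewrite -(card_imset _ H_inj); congr #|pred_of_set _|.
have properH k : proper e (H k) = proper e k.
  apply: eq_forallb => u; apply: eq_forallb => v.
  by rewrite !ffunE (inj_eq h_inj).
have mon_H k : mon_prod predT (fun v => val (H k v))
             = mon_prod predT (fun v => val (k v)).
  by apply: eq_bigr => v _; rewrite ffunE.
apply/setP => k; rewrite inE; apply/imsetP/andP => [[k' + ->]|[pk mk]].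
  by rewrite inE properH mon_H => /andP.
have k_supp v : val (k v) \in finsupp m.
  by rewrite -(eqP mk); apply: (@mon_prod_supp _ predT (fun v => val (k v))).
have Ek : k = H [ffun v => [` k_supp v]%fset].
  by apply/ffunP => v; rewrite !ffunE; apply/val_inj.
by exists [ffun v => [` k_supp v]%fset]; rewrite // inE -properH -mon_H -Ek pk.
Qed.

(** The roots of unity enter through this form: there the product on the right
    is known in closed form. *)
Lemma series_eval_esym_coef k : (k <= N)%N ->
  series_eval k (elem_sym k) = (\prod_(i < N) ('X + (x i)%:P))`_(N - k).
Proof.
move=> le_kN; rewrite bigA_distr coef_sum series_eval_esym.
rewrite [RHS](reindex_inj (@setC_inj _)) big_mkcond /=.
apply: eq_bigr => J _.
transitivity ((\prod_(j in J) (x j)%:P * 'X^(N - #|J|))`_(N - k)); last first.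
  congr (polyseq _)`_(N - k); rewrite [RHS](bigID (mem J)) /=; congr (_ * _).
    by apply: eq_bigr => j jJ; rewrite inE jJ.
  rewrite (eq_bigr (fun=> 'X)) => [|j njJ]; last by rewrite inE njJ.
  rewrite prodr_const; congr ('X^_); have := cardsC J; rewrite card_ord => EN.
  have -> : (N - #|J| = #|~: J|)%N by lia.
  by apply: eq_card => j; rewrite !inE.
rewrite -(rmorph_prod (@polyC _)) coefCM coefXn.
have -> : (N - k == N - #|J|)%N = (#|J| == k).
  have leJ : (#|J| <= #|'I_N|)%N := max_card _.
  by rewrite card_ord in leJ; lia.
by case: eqP; rewrite ?mulr1 ?mulr0.
Qed.

End Evaluation.

(** * Branches of a tree and orientations with two sinks *)

Lemma card_sum_mem (T : finType) (A : {pred T}) : #|A| = (\sum_x (x \in A))%N.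
Proof. by rewrite -sum1_card big_mkcond; apply: eq_bigr => x _; case: (x \in A). Qed.

Definition avoid (V : finType) (e : rel V) (x : V) : rel V :=
  [rel u v | [&& e u v, u != x & v != x]].

Lemma avoidE (V : finType) (e : rel V) x u v :
  avoid e x u v = [&& e u v, u != x & v != x].
Proof. by []. Qed.

(** For an edge xy of a tree, the component of y in T - x, which is also the side
    of y when the edge xy is deleted. *)
Definition branch (V : finType) (e : rel V) (x y : V) : {set V} :=
  [set v | connect (avoid e x) y v].

Definition separates (V : finType) (e : rel V) (p a b : V) : bool :=
  [&& a != p, b != p & ~~ connect (avoid e p) a b].

(** Negating all three arguments negates the majority.  Reversing an arc
    complements its branch, hence an orientation defined by a majority of three
    such conditions contains exactly one of the two arcs of each edge. *)
Definition maj (P Q R : bool) : bool := P && Q || R && (P || Q).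

(** An arc that leads away from p is kept if a or b lies beyond it, and an arc
    that leads towards p is kept if both a and b lie beyond it. *)
Definition two_sink_orientation (V : finType) (e : rel V) (p a b : V) :
    {set V * V} :=
  [set u | e u.1 u.2 && maj (a \in branch e u.1 u.2) (b \in branch e u.1 u.2)
                            (p \notin branch e u.1 u.2)].

Definition arcs (V : finType) (e : rel V) : {set V * V} :=
  [set u | e u.1 u.2].

Section Branches.

Variables (V : finType) (e : rel V).
Hypothesis tree_e : is_tree e.

Lemma tree_sym x y : e x y = e y x.
Proof. by case: tree_e => -[sym_e _] _ _ _; apply: sym_e. Qed.

Lemma tree_neq x y : e x y -> x != y.
Proof.
case: tree_e => -[_ irr_e] _ _ _ exy.
by apply: contraTneq exy => ->; rewrite irr_e.
Qed.

Lemma avoid_sym x : connect_sym (avoid e x).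
Proof.
apply: sym_connect_sym => u v.
by rewrite !avoidE tree_sym [(v != x) && _]andbC.
Qed.

Lemma path_avoid x y s : y != x ->
  path (avoid e x) y s = path e y s && (x \notin s).
Proof.
elim: s y => [|z s IHs] y ne_yx //=; rewrite avoidE inE negb_or ne_yx /= [x == z]eq_sym.
have [->|ne_zx] /= := eqVneq z x; first by rewrite !andbF.
by rewrite IHs // andbT andbA.
Qed.

Lemma connect_avoid_neq x u v : u != x -> connect (avoid e x) u v -> v != x.
Proof.
move=> ne_ux /connectP[s + ->]; rewrite path_avoid // => /andP[_ nsx].
have : last u s \in u :: s by apply: mem_last.
by rewrite inE => /predU1P[->//|]; apply: contraTneq => ->.
Qed.

(** A component of T - x that does not contain w is still connected in T - w. *)
Lemma connect_avoid_other x w u v : connect (avoid e x) u v ->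
  ~~ connect (avoid e x) u w -> connect (avoid e w) u v.
Proof.
move=> /connectP[s + ->]; elim: s u => [|z s IHs] u /=; first by rewrite connect0.
move=> /andP[uz path_s] nuw; have cuz := connect1 uz.
have nzw : ~~ connect (avoid e x) z w.
  by apply: contra nuw; apply: connect_trans.
apply: connect_trans (IHs z path_s nzw); apply: connect1.
move: uz; rewrite !avoidE => /and3P[-> _ _] /=.
by apply/andP; split; [apply: contraNneq nuw => ->|apply: contraNneq nzw => ->].
Qed.

Lemma mem_branch_root x y : y \in branch e x y.
Proof. by rewrite inE connect0. Qed.

Lemma branch_notin x y v : e x y -> v \in branch e x y -> v != x.
Proof.
by move=> exy; rewrite inE; apply: connect_avoid_neq; rewrite eq_sym tree_neq.
Qed.

Lemma branch_connect x y u v : u \in branch e x y ->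
  (v \in branch e x y) = connect (avoid e x) u v.
Proof. by rewrite !inE => cyu; apply: (same_connect (@avoid_sym x)). Qed.

Lemma branch_ex x v : v != x -> exists2 y, e x y & v \in branch e x y.
Proof.
case: tree_e => _ _ conn_e _ ne_vx; have /connectP[s] := conn_e x v.
case/shortenP => -[|y t] /=; first by move=> _ _ _ Ev; rewrite Ev eqxx in ne_vx.
rewrite inE negb_or => /andP[exy path_t] /andP[/andP[ne_xy nxt] _] _ ->.
exists y => //; rewrite inE; apply/connectP; exists t => //.
by rewrite path_avoid ?path_t // eq_sym.
Qed.

(** Two neighbours of x joined by a path that avoids x would close a cycle. *)
Lemma branch_root_inj x y z : e x y -> e x z -> z \in branch e x y -> y = z.
Proof.
case: tree_e => _ _ _ no_cycle exy exz; rewrite inE => /connectP[s].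
case/shortenP => t path_t uniq_t _ Ez.
move: path_t; rewrite path_avoid 1?eq_sym ?tree_neq // => /andP[path_t nxt].
case: t => [|w t] in path_t uniq_t Ez nxt *; first by rewrite Ez.
case: (no_cycle [:: x, y, w & t]) => //; apply/andP; split; last first.
  by rewrite cons_uniq uniq_t andbT inE negb_or nxt tree_neq.
rewrite (cycle_path x) /=; move: Ez path_t => /= <- ->.
by rewrite tree_sym exz exy.
Qed.

Lemma branch_inj x y z v : e x y -> e x z ->
  v \in branch e x y -> v \in branch e x z -> y = z.
Proof.
move=> exy exz vy vz; apply: (branch_root_inj exy exz).
by rewrite (branch_connect _ vy) -(branch_connect _ vz) mem_branch_root.
Qed.

Lemma branchC x y : e x y -> branch e y x = ~: branch e x y.
Proof.
move=> exy; have eyx : e y x by rewrite tree_sym.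
apply/setP => v; rewrite in_setC; apply/idP/idP => [vyx|nvxy]; last first.
  have [->|ne_vx] := eqVneq v x; first exact: mem_branch_root.
  have [z exz vz] := branch_ex ne_vx.
  have ne_zy : z != y by apply: contraNneq nvxy => <-.
  have nzy : ~~ connect (avoid e x) z y.
    by apply: contra ne_zy => czy; rewrite (branch_root_inj exz exy) // inE.
  rewrite inE; apply: connect_trans (connect_avoid_other _ nzy).
    by apply: connect1; rewrite avoidE exz ne_zy tree_neq.
  by move: vz; rewrite inE.
apply: contraL vyx => vxy; apply/negP; rewrite inE => /connectP[s].
case/shortenP => -[|z t] path_t uniq_t _ Ev.
  by move: (branch_notin exy vxy); rewrite Ev eqxx.
move: path_t uniq_t; rewrite path_avoid ?tree_neq //= => /andP[/andP[exz path_t]].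
rewrite inE !negb_or => /andP[ne_yz _] /andP[/andP[ne_xz nxt] _].
move/eqP: ne_yz; apply; apply: branch_inj exy exz vxy _.
rewrite inE; apply/connectP; exists t => //.
by rewrite path_avoid ?path_t // eq_sym.
Qed.

Lemma edge_leaving_branch x y u v : e x y -> e u v ->
  u \in branch e x y -> v \notin branch e x y -> u = y /\ v = x.
Proof.
move=> exy euv u_in v_out; have ne_ux := branch_notin exy u_in.
have Ev : v = x.
  apply/eqP; apply: contraNT v_out => ne_vx.
  by rewrite (branch_connect _ u_in) connect1 // avoidE euv ne_ux.
split=> //; apply: (@branch_inj x _ _ u) => //; last exact: mem_branch_root.
by rewrite -Ev tree_sym.
Qed.

Lemma separatesC p a b : separates e p a b = separates e p b a.
Proof. by rewrite /separates avoid_sym andbCA. Qed.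

(** The branch at p that contains b, together with p, is connected and misses a. *)
Lemma separates_connect p a b : separates e p a b -> connect (avoid e a) p b.
Proof.
case/and3P=> ne_ap ne_bp nab; have [z epz bz] := branch_ex ne_bp.
have naz : a \notin branch e p z.
  apply: contra nab => az; rewrite -(branch_connect _ az) //.
move: (naz) (bz); rewrite !inE => nza czb.
apply: connect_trans (connect_avoid_other czb nza).
apply: connect1; rewrite avoidE epz eq_sym ne_ap /=.
by apply: contraNneq naz => <-; apply: mem_branch_root.
Qed.

Lemma orientation_acyclic o : is_orientation e o -> acyclic o.
Proof.
move=> /forallP or_o; apply/existsPn => x; apply/existsPn => y.
have o_e u v : (u, v) \in o -> e u v /\ (v, u) \notin o.
  by move: (or_o u) => /forallP/(_ v); case: (e u v) => [+ uv|/negbTE->//]; rewrite uv.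
apply/negP => /andP[xy /connectP[s]]; case/shortenP => t path_t uniq_t _ Ex.
have [exy nyx] := o_e _ _ xy.
have path_e : path e y t by apply: sub_path path_t => u v /o_e[].
case: tree_e => _ _ _ no_cycle.
case: t => [|w [|w' t]] in path_t uniq_t Ex path_e *.
- by move: (tree_neq exy); rewrite Ex eqxx.
- by move: path_t nyx; rewrite /= andbT Ex /= => ->.
apply: (no_cycle [:: y, w, w' & t]) => //; apply/andP; split=> //.
by rewrite (cycle_path y) /=; move: Ex path_e => /= <- ->; rewrite exy.
Qed.

Lemma two_sink_orientationC p a b :
  two_sink_orientation e p a b = two_sink_orientation e p b a.
Proof.
by apply/setP => u; rewrite !inE; congr (_ && _); do 3!case: connect.
Qed.

Lemma is_orientation_two_sink p a b :
  is_orientation e (two_sink_orientation e p a b).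
Proof.
apply/forallP => x; apply/forallP => y.
rewrite [(x, y) \in _]in_set [(y, x) \in _]in_set /= [e y x]tree_sym; case exy: (e x y) => //=.
rewrite (branchC exy) !in_setC.
by case: (a \in _); case: (b \in _); case: (p \in _).
Qed.

(** At a the vertices p and b lie in the same branch, so the conditions on b and
    on p in the majority exclude each other. *)
Lemma sink_two_sink p a b : separates e p a b ->
  a \in sinks (two_sink_orientation e p a b).
Proof.
move=> sep; rewrite inE; apply/forallP => y; rewrite inE /=.
have [eay /=|//] := boolP (e a y).
have -> : (a \in branch e a y) = false.
  by apply/negP => /(branch_notin eay); rewrite eqxx.
have cpb := separates_connect sep; rewrite /maj /= !inE.
by rewrite (same_connect_r (@avoid_sym a) cpb) andNb.
Qed.

(** From any third vertex x the arc towards a or the arc towards b is kept: if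
    neither is, p lies in the branch of a and in that of b, so these coincide,
    and the arc towards this branch is kept. *)
Lemma sinks_two_sink p a b : separates e p a b ->
  sinks (two_sink_orientation e p a b) = [set a; b].
Proof.
move=> sep; apply/setP => x; rewrite in_set2; apply/idP/orP => [|[]/eqP->]; last 2 first.
- exact: sink_two_sink.
- by rewrite two_sink_orientationC sink_two_sink // separatesC.
have [->|ne_xa] := eqVneq x a; first by left.
have [->|ne_xb] := eqVneq x b; first by right.
move=> x_sink; exfalso; move: x_sink.
have [y exy ay] : exists2 y, e x y & a \in branch e x y by apply: branch_ex; rewrite eq_sym.
have [z exz bz] : exists2 z, e x z & b \in branch e x z by apply: branch_ex; rewrite eq_sym.
rewrite inE => /forallP sink_x.
have arcE u : e x u ->
    ~~ maj (a \in branch e x u) (b \in branch e x u) (p \notin branch e x u).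
  by move=> exu; move: (sink_x u); rewrite [_ \in two_sink_orientation _ _ _ _]in_set /= exu.
have := arcE y exy; have := arcE z exz; rewrite ay bz /maj.
case pz: (p \in branch e x z); rewrite ?andbT ?orbT //= => _.
case pyx: (p \in branch e x y); rewrite ?orbT ?andbT //=.
by rewrite (branch_inj exy exz pyx pz) bz.
Qed.

(** If p' lies in branch p z, the orientations for p and p' agree on the
    arc (p, z) only if a and b are both on the side of p of this edge, and then
    p' does not separate them. *)
Lemma two_sink_orientation_inj p p' a b :
    separates e p a b -> separates e p' a b ->
  two_sink_orientation e p a b = two_sink_orientation e p' a b -> p = p'.
Proof.
move=> sep sep' /setP eq_o; apply/eqP/negPn/negP => ne_pp'.
have [z epz p'z] : exists2 z, e p z & p' \in branch e p z by apply: branch_ex; rewrite eq_sym.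
have pz : p \notin branch e p z by apply/negP => /(branch_notin epz); rewrite eqxx.
have := eq_o (p, z); rewrite [LHS]in_set [RHS]in_set /= epz p'z pz /maj /=.
have nab : ~~ ((a \in branch e p z) && (b \in branch e p z)).
  apply/negP => /andP[az bz]; case/and3P: sep => _ _ /negP[].
  by rewrite -(branch_connect _ az).
rewrite (negbTE nab) /= => /negbT /norP[naz nbz].
have branchzp : branch e z p = ~: branch e p z by apply: branchC.
have az : a \in branch e z p by rewrite branchzp in_setC.
have bz : b \in branch e z p by rewrite branchzp in_setC.
have p'zp : p' \notin branch e z p by rewrite branchzp in_setC negbK.
case/and3P: sep' => _ _ /negP[]; apply: (@connect_avoid_other z).
  by rewrite -(branch_connect _ az).
by rewrite -(branch_connect _ az).
Qed.

End Branches.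

(** * Counting two-sink orientations by branch sizes *)

Section Counting.

Local Open Scope nat_scope.

Variables (V : finType) (e : rel V).
Hypothesis tree_e : is_tree e.

Lemma sum_arcs (F : V -> V -> nat) :
  \sum_(u in arcs e) F u.1 u.2 = \sum_x \sum_(y | e x y) F x y.
Proof. by rewrite pair_big_dep; apply: eq_bigl => -[x y]; rewrite inE. Qed.

(** The branches at p partition the other vertices, so a and b lie in at most one
    common branch. *)
Lemma sum_branch_mem2 p a b :
  \sum_(y | e p y) (a \in branch e p y) * (b \in branch e p y)
    = [&& a != p, b != p & connect (avoid e p) a b].
Proof.
have [->|ne_ap] /= := eqVneq a p.
  rewrite big1 // => y epy; case: (boolP (p \in _)) => //.
  by move=> /(branch_notin tree_e epy); rewrite eqxx.
have [y epy ay] := branch_ex tree_e ne_ap.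
rewrite (bigD1 y) //= ay mul1n big1 ?addn0 => [|z /andP[epz ne_zy]]; last first.
  case: (boolP (a \in branch e p z)) => // az.
  by rewrite (branch_inj tree_e epy epz ay az) eqxx in ne_zy.
rewrite (branch_connect tree_e _ ay); case: eqP => // ->.
apply/eqP; rewrite eqb0; apply/negP => cap.
by move: (connect_avoid_neq ne_ap cap); rewrite eqxx.
Qed.

Lemma sum_branch_mem p a : \sum_(y | e p y) (a \in branch e p y) = (a != p).
Proof.
transitivity (\sum_(y | e p y) (a \in branch e p y) * (a \in branch e p y)).
  by apply: eq_bigr => y _; rewrite mulnb andbb.
by rewrite sum_branch_mem2 connect0 andbT andbb.
Qed.

Lemma sum_card_branch :
  \sum_(u in arcs e) #|branch e u.1 u.2| = #|V| * #|V|.-1.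
Proof.
rewrite (sum_arcs (fun x y => #|branch e x y|)).
rewrite (eq_bigr (fun=> #|V|.-1)) ?sum_nat_const // => p _.
under eq_bigr do rewrite card_sum_mem.
rewrite exchange_big /= -(cardC1 p) card_sum_mem.
by apply: eq_bigr => a _; rewrite sum_branch_mem inE.
Qed.

Lemma card_separates :
  #|[set t : V * (V * V) | separates e t.1 t.2.1 t.2.2]|
    + \sum_(u in arcs e) #|branch e u.1 u.2| ^ 2 = #|V| * #|V|.-1 ^ 2.
Proof.
rewrite card_sum_mem (eq_bigr (fun t : V * (V * V) =>
  nat_of_bool (separates e t.1 t.2.1 t.2.2))) => [|t _]; last by rewrite inE.
rewrite -(pair_bigA _ (fun p (u : V * V) => nat_of_bool (separates e p u.1 u.2))) /=.
rewrite (sum_arcs (fun x y => #|branch e x y| ^ 2)) -big_split /=.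
rewrite (eq_bigr (fun=> #|V|.-1 ^ 2)) ?sum_nat_const // => p _.
rewrite -(pair_bigA _ (fun a b => nat_of_bool (separates e p a b))) /=.
have -> : \sum_(y | e p y) #|branch e p y| ^ 2
    = \sum_(y | e p y) \sum_a \sum_b (a \in branch e p y) * (b \in branch e p y).
  apply: eq_bigr => y _.
  by rewrite -mulnn card_sum_mem big_distrl; apply: eq_bigr => a _; rewrite big_distrr.
rewrite [X in _ + X = _]exchange_big -big_split /= -(cardC1 p) card_sum_mem -mulnn big_distrl.
apply: eq_bigr => a _; rewrite [X in _ + X = _]exchange_big -big_split big_distrr /=.
apply: eq_bigr => b _; rewrite sum_branch_mem2 /separates !inE.
by case: (a == p); case: (b == p); case: connect.
Qed.

(** A triple (p, a, b) is recovered from its orientation and the choice of the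
    sink a; the factor 2 is the number of choices. *)
Lemma card_separates_le :
  #|[set t : V * (V * V) | separates e t.1 t.2.1 t.2.2]|
    <= 2 * #|acyclic_orientations_with_sinks e 2|.
Proof.
pose f (t : V * (V * V)) := (two_sink_orientation e t.1 t.2.1 t.2.2, t.2.1).
pose W := [set w : {set V * V} * V |
  (w.1 \in acyclic_orientations_with_sinks e 2) && (w.2 \in sinks w.1)].
have sep_neq p a b : separates e p a b -> a != b.
  by case/and3P=> _ _; apply: contraNneq => ->; apply: connect0.
have <- : #|W| = 2 * #|acyclic_orientations_with_sinks e 2|.
  rewrite -sum1_card (eq_bigl (fun w => (w.1 \in acyclic_orientations_with_sinks e 2)
    && (w.2 \in sinks w.1))) => [|w]; last by rewrite inE.
  rewrite -(pair_big_dep (fun o => o \in acyclic_orientations_with_sinks e 2)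
    (fun (o : {set V * V}) x => x \in sinks o) (fun _ _ => 1)) /=.
  under eq_bigr => o do [rewrite inE => /and3P[_ _ /eqP so]; rewrite sum1_card so].
  by rewrite sum_nat_const mulnC.
rewrite -(card_in_imset (f := f)) => [|[p [a b]] [p' [a' b']]]; last first.
  rewrite !in_set /= => sep sep' [eq_o eq_a]; subst a'.
  have eq_b : b = b'.
    have := sinks_two_sink tree_e sep; rewrite eq_o (sinks_two_sink tree_e sep').
    move/setP/(_ b'); rewrite !in_set2 eqxx orbT eq_sym (negbTE (sep_neq _ _ _ sep')) /=.
    by move/esym/eqP.
  by subst b'; rewrite (two_sink_orientation_inj tree_e sep sep' eq_o).
apply/subset_leq_card/subsetP => _ /imsetP[[p [a b]] + ->].
rewrite in_set /= => sep; have or_o := is_orientation_two_sink tree_e p a b.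
rewrite [_ \in W]in_set [_ \in acyclic_orientations_with_sinks _ _]in_set /=.
rewrite or_o (orientation_acyclic tree_e) // sinks_two_sink //=.
by rewrite cards2 (sep_neq _ _ _ sep) set21.
Qed.

Lemma card_branchC x y : e x y -> #|branch e x y| + #|branch e y x| = #|V|.
Proof. by move=> exy; rewrite (branchC tree_e exy) cardsC. Qed.

Lemma card_branch_gt0 x y : 0 < #|branch e x y|.
Proof. by apply/card_gt0P; exists y; apply: mem_branch_root. Qed.

(** The right-hand side runs over arcs, so it is twice the sum over the edges of
    the products of the branch sizes, which is the Wiener index of the tree. *)
Lemma wiener_sum :
  #|[set t : V * (V * V) | separates e t.1 t.2.1 t.2.2]| + #|V| * #|V|.-1
  = \sum_(u in arcs e) #|branch e u.1 u.2| * (#|V| - #|branch e u.1 u.2|).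
Proof.
have H1 := card_separates; have H2 := sum_card_branch.
have H3 : \sum_(u in arcs e) #|branch e u.1 u.2| * (#|V| - #|branch e u.1 u.2|)
    + \sum_(u in arcs e) #|branch e u.1 u.2| ^ 2 = #|V| * (#|V| * #|V|.-1).
  rewrite -H2 big_distrr -big_split; apply: eq_bigr => u _ /=.
  by rewrite -mulnn -mulnDr subnK ?max_card // mulnC.
have V_gt0 : 0 < #|V| by case: tree_e.
apply/(@addIn (\sum_(u in arcs e) #|branch e u.1 u.2| ^ 2)).
rewrite H3 addnAC H1 -mulnDr; congr (_ * _).
by rewrite -mulnn addnC -mulSn prednK.
Qed.

Lemma card_branch_leaf x y : e x y -> x \in leaves e -> #|branch e x y| = #|V|.-1.
Proof.
move=> exy; rewrite inE => /cards1P[w Ew].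
have only_y z : e x z -> z = y.
  have inw u : e x u -> u = w by move=> exu; apply/set1P; rewrite -Ew inE.
  by move=> /inw->; rewrite -(inw y).
rewrite -(cardC1 x); apply: eq_card => v; rewrite [RHS]inE.
apply/idP/idP => [|/(branch_ex tree_e)[z exz]]; first exact: (branch_notin tree_e exy).
by rewrite (only_y z).
Qed.

(** The larger of the two branch sizes, so that both arcs of an edge fall in the
    same class. *)
Definition split_size (u : V * V) : nat :=
  maxn #|branch e u.1 u.2| (#|V| - #|branch e u.1 u.2|).

Lemma split_size_leaf x y : e x y -> (x \in leaves e) || (y \in leaves e) ->
  split_size (x, y) = #|V|.-1.
Proof.
move=> exy; have eyx : e y x by rewrite (tree_sym tree_e).
move=> /orP[/(card_branch_leaf exy)|/(card_branch_leaf eyx)];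
  have := card_branchC exy; have := card_branch_gt0 x y;
  have := card_branch_gt0 y x; rewrite /split_size /=; lia.
Qed.

(** Both arcs of a leaf edge count; on more than two vertices no edge joins two
    leaves, so no arc is counted twice. *)
Lemma card_leaf_arcs : 2 < #|V| ->
  2 * #|leaves e| <= #|[set u in arcs e | split_size u == #|V|.-1]|.
Proof.
move=> V_gt2; pose L1 := [set u in arcs e | u.1 \in leaves e].
pose L2 := [set u in arcs e | u.2 \in leaves e].
have cL1 : #|L1| = #|leaves e|.
  rewrite -!sum1_card (eq_bigl (fun u => (u.1 \in leaves e) && e u.1 u.2)) => [|u].
    rewrite -(pair_big_dep (fun x => x \in leaves e) e (fun _ _ => 1)) /=.
    apply: eq_bigr => x; rewrite inE => /eqP cx; rewrite -[RHS]cx -sum1_card.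
    by apply: eq_bigl => y; rewrite inE.
  by rewrite !in_set andbC.
have cL2 : #|L2| = #|leaves e|.
  rewrite -cL1 -(card_imset L1 (can_inj swap_pairK)); apply: eq_card => -[x y].
  apply/idP/imsetP => [|[[y' x'] + [-> ->]]]; rewrite !in_set /= (tree_sym tree_e) //.
  by move=> ?; exists (y, x); rewrite ?in_set.
have disj : [disjoint L1 & L2].
  apply/pred0P => -[x y]; apply/negP => /andP[/=].
  rewrite [_ \in L1]in_set [_ \in L2]in_set [_ \in arcs e]in_set /=.
  move=> /andP[exy /(card_branch_leaf exy) bx] /andP[_ ly].
  have eyx : e y x by rewrite (tree_sym tree_e).
  by have := card_branchC exy; have := card_branch_leaf eyx ly; lia.
have /eqP cU : #|L1 :|: L2| == #|L1| + #|L2| by rewrite leq_card_setU.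
rewrite mul2n -addnn -{1}cL1 -cL2 -cU; apply/subset_leq_card/subsetP => -[x y].
rewrite in_setU [_ \in L1]in_set [_ \in L2]in_set [_ \in arcs e]in_set -andb_orr /=.
move=> /andP[exy lxy]; rewrite in_set (split_size_leaf exy lxy) eqxx andbT.
by rewrite in_set.
Qed.

Lemma card_split_arcs x y : e x y ->
  2 <= #|[set u in arcs e | split_size u == split_size (x, y)]|.
Proof.
move=> exy; have eyx : e y x by rewrite (tree_sym tree_e).
have := cards2 (x, y) (y, x).
rewrite xpair_eqE (negbTE (tree_neq tree_e exy)) /= => <-.
apply/subset_leq_card/subsetP => u /set2P[]->; rewrite !in_set /= ?exy ?eqxx // eyx.
by apply/eqP; have := card_branchC exy; rewrite /split_size /=; lia.
Qed.

(** Group the arcs by split size k: each class with n/2 <= k <= n - 2 contains the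
    two arcs of some edge, and the class k = n - 1 contains those of the leaf
    edges. *)
Lemma wiener_ge : 2 < #|V| ->
    (forall k, uphalf #|V| <= k < #|V|.-1 ->
       exists x y, e x y /\ #|branch e x y| = k) ->
  2 * (\sum_(uphalf #|V| <= k < #|V|.-1) k * (#|V| - k) + #|leaves e| * #|V|.-1)
    <= \sum_(u in arcs e) #|branch e u.1 u.2| * (#|V| - #|branch e u.1 u.2|).
Proof.
move=> V_gt2 splits; set n := #|V| in V_gt2 splits *.
have split_lt u : u \in arcs e -> split_size u < n.
  case: u => x y; rewrite inE /= => exy; have := card_branchC exy.
  by have := card_branch_gt0 x y; have := card_branch_gt0 y x; rewrite /split_size /n /=; lia.
rewrite (eq_bigr (fun u => split_size u * (n - split_size u))) => [|u _]; last first.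
  have leV : #|branch e u.1 u.2| <= n := max_card _.
  rewrite /split_size -/n; case: leqP => // _; rewrite subKn //; exact: mulnC.
rewrite (partition_big (fun u => inord (split_size u) : 'I_n.-1.+1) predT) //=.
pose c k := #|[set u in arcs e | split_size u == k]|.
rewrite (eq_bigr (fun k : 'I_n.-1.+1 => c k * (k * (n - k)))) => [|k _]; last first.
  rewrite /c -sum_nat_const; apply: eq_big => [u|u /andP[ue /eqP <-]].
    rewrite [RHS]in_set; case ue: (u \in arcs e) => //=.
    by rewrite -val_eqE /= inordK // prednK ?split_lt //; lia.
  by rewrite inordK // prednK ?split_lt //; lia.
rewrite -(big_mkord predT (fun k => c k * (k * (n - k)))).
rewrite big_nat_recr //= (@big_cat_nat _ _ _ (uphalf n) 0 n.-1) //=; last by lia.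
rewrite -addnA.
apply: leq_trans (leq_addl _ _); rewrite mulnDr big_distrr; apply: leq_add.
  rewrite big_nat_cond [leqRHS]big_nat_cond; apply: leq_sum => k /andP[k_range _].
  have [x [y [exy bk]]] := splits k k_range.
  have Ek : split_size (x, y) = k by rewrite /split_size /= bk -/n; lia.
  by have := card_split_arcs exy; rewrite Ek => ck; rewrite leq_mul2r /c ck orbT.
have -> : n - n.-1 = 1 by lia.
by rewrite muln1 mulnA leq_mul2r; apply/orP; right; apply: card_leaf_arcs.
Qed.

End Counting.

(** * Proper colourings by roots of unity *)

(** All cancellations between colourings below come from this: a sum that a
    relabelling multiplies by z <> 1 is zero. *)
Lemma sum_eq0_shift (R : idomainType) (I : finType) (P : pred I) (F : I -> R)
    (h : I -> I) (z : R) :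
    injective h -> (forall i, P (h i) = P i) ->
    (forall i, P i -> F (h i) = z * F i) -> z != 1 ->
  \sum_(i | P i) F i = 0.
Proof.
move=> h_inj Ph Fh; rewrite -subr_eq0 => /mulfI-/(_ _ 0); apply.
rewrite mulr0 mulrBl mul1r [X in _ - X](reindex_inj h_inj) big_distrr /=.
rewrite (eq_bigl _ _ Ph) -sumrB big1 // => i Pi.
by rewrite Fh // subrr.
Qed.

Definition recolour (V I : finType) (rot : I -> I) (C : {set V})
    (kappa : {ffun V -> I}) : {ffun V -> I} :=
  [ffun v => if v \in C then rot (kappa v) else kappa v].

Lemma recolour_inj (V I : finType) (rot : I -> I) (C : {set V}) :
  injective rot -> injective (recolour rot C).
Proof.
move=> rot_inj k1 k2 /ffunP eq_k; apply/ffunP => v; move: (eq_k v).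
by rewrite !ffunE; case: ifP => // _ /rot_inj.
Qed.

Lemma prod_recolour (R : comNzRingType) (V I : finType) (rot : I -> I)
    (C : {set V}) (kappa : {ffun V -> I}) (w : I -> R) (z : R) :
    {in C, forall v, w (rot (kappa v)) = z * w (kappa v)} ->
  \prod_v w (recolour rot C kappa v) = z ^+ #|C| * \prod_v w (kappa v).
Proof.
move=> w_rot; rewrite -prodr_const [X in X * _]big_mkcond -big_split.
apply: eq_bigr => v _ /=; rewrite ffunE; case: ifP => [vC|_]; last by rewrite mul1r.
exact: w_rot.
Qed.

Lemma prim_expr_neq1 (n k : nat) (z : algC) : n.-primitive_root z ->
  (0 < k < n)%N -> z ^+ k != 1.
Proof. by move=> prim_z k_n; rewrite -(prim_order_dvd prim_z) gtnNdvd; case/andP: k_n. Qed.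

Section RootColourings.

Variables (V : finType) (e : rel V).
Hypothesis tree_e : is_tree e.

Lemma connect_const (T : eqType) (f : V -> T) :
  (forall x y, e x y -> f x = f y) -> forall x y, f x = f y.
Proof.
move=> f_e x y; case: tree_e => _ _ /(_ x y) /connectP[s path_s ->] _.
elim: s x path_s => //= z s IHs x /andP[/f_e -> /IHs//].
Qed.

(** One arc for each edge, chosen by an arbitrary order of the vertices. *)
Definition edges : {set V * V} :=
  [set u in arcs e | enum_rank u.1 < enum_rank u.2]%N.

Lemma mem_edges x y : e x y -> ((x, y) \in edges) (+) ((y, x) \in edges).
Proof.
move=> exy; rewrite !inE /= exy (tree_sym tree_e) exy /=.
have := tree_neq tree_e exy; rewrite -(inj_eq enum_rank_inj) -val_eqE /=.
by case: ltngtP.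
Qed.

Lemma properE (I : finType) (kappa : {ffun V -> I}) :
  proper e kappa = [forall u in edges, kappa u.1 != kappa u.2].
Proof.
apply/'forall_forallP/forall_inP => /= [prop_k [x y]|prop_k x y].
  by rewrite !inE => /andP[exy _]; apply: (implyP (prop_k x y)).
apply/implyP => exy; have := mem_edges exy.
case: ((x, y) \in edges) (prop_k (x, y)) => [-> //|_ /= yx].
by rewrite eq_sym (prop_k (y, x)).
Qed.

(** Inclusion-exclusion over the edges on which the colouring is not proper. *)
Lemma proper_expand (R : comNzRingType) (I : finType) (kappa : {ffun V -> I}) :
  (proper e kappa)%:R = \sum_(J : {set V * V} | J \subset edges)
     (-1) ^+ #|J| * [forall u in J, kappa u.1 == kappa u.2]%:R :> R.
Proof.
pose F (u : V * V) : R := - ((u \in edges) && (kappa u.1 == kappa u.2))%:R.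
transitivity (\prod_u (F u + 1)).
  rewrite properE; case: forall_inP => [prop_k|/forall_inP].
    rewrite big1 // => u _; rewrite /F; case: (boolP (u \in edges)) => /= [/prop_k/negbTE->|_];
    by rewrite oppr0 add0r.
  rewrite negb_forall_in => /exists_inP[u ue]; rewrite negbK => eq_u.
  by rewrite (bigD1 u) //= /F ue eq_u /= addNr mul0r.
rewrite bigA_distr [RHS]big_mkcond; apply: eq_bigr => J _ /=.
rewrite -big_mkcond /=; case: ifP => [/subsetP J_e|/negbT/subsetPn[u uJ une]]; last first.
  by rewrite (bigD1 u) //= /F (negbTE une) oppr0 mul0r.
rewrite (eq_bigr (fun u => -1 * (kappa u.1 == kappa u.2)%:R)) => [|u /J_e ue]; last first.
  by rewrite /F ue mulN1r.
rewrite big_split /= prodr_const; congr (_ * _).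
case: forall_inP => [eqJ|/forall_inP].
  by rewrite big1 // => u /eqJ ->.
by rewrite negb_forall_in => /exists_inP[u uJ /negbTE ne_u]; rewrite (bigD1 u) //= ne_u mul0r.
Qed.

(** For a proper subset J of the edges, the colourings that are constant on the
    edges of J cancel: delete an edge outside J and rotate the colours on one of
    the two branches.  For the set of all edges only the constant colourings
    remain, and each of them contributes (-1)^n. *)
Lemma chromatic_root_neq0 (z : algC) : #|V|.-primitive_root z ->
  \sum_(kappa : {ffun V -> 'I_#|V|} | proper e kappa) \prod_v - z ^+ kappa v != 0.
Proof.
move=> prim_z; have V_gt0 := prim_order_gt0 prim_z.
pose eqs (J : {set V * V}) (kappa : {ffun V -> 'I_#|V|}) :=
  [forall u in J, kappa u.1 == kappa u.2].
have rot_z (i : 'I_#|V|) : - z ^+ ordS i = z * - z ^+ i.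
  by rewrite mulrN -exprS /= prim_expr_mod.
have eqs0 (J : {set V * V}) : J \proper edges ->
    \sum_(kappa | eqs J kappa) \prod_v - z ^+ kappa v = 0.
  move=> /properP[/subsetP J_e [[x y] xy_e nJ]].
  have exy : e x y by move: xy_e; rewrite !inE => /andP[].
  have J_C u : u \in J -> (u.1 \in branch e x y) = (u.2 \in branch e x y).
    case: u => x' y' uJ /=; have ue := J_e _ uJ.
    have ex'y' : e x' y' by move: ue; rewrite !inE => /andP[].
    apply/idP/idP => [x'C|y'C]; apply: contraT => out.
      have [Ex Ey] := edge_leaving_branch tree_e exy ex'y' x'C out.
      by move: (mem_edges exy); rewrite xy_e -Ex -Ey ue.
    have ey'x' : e y' x' by rewrite (tree_sym tree_e).
    have [Ey Ex] := edge_leaving_branch tree_e exy ey'x' y'C out.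
    by move: nJ; rewrite -Ex -Ey uJ.
  apply: (sum_eq0_shift (h := recolour (@ordS _) (branch e x y)) (z := z ^+ #|branch e x y|)).
  - exact/recolour_inj/can_inj/ordSK.
  - move=> kappa; apply: eq_forallb => u; case uJ: (u \in J) => //=.
    rewrite !ffunE (J_C u uJ); case: ifP => // _.
    by rewrite (inj_eq (can_inj (@ordSK _))).
  - by move=> kappa _; apply: (prod_recolour (w := fun i : 'I__ => - z ^+ i)) => v _.
  - apply: (prim_expr_neq1 prim_z).
    have eyx : e y x by rewrite (tree_sym tree_e).
    rewrite card_branch_gt0 -(cardsC (branch e x y)) -(branchC tree_e exy).
    by rewrite -[ltnLHS]addn0 ltn_add2l card_branch_gt0.
have -> : \sum_(kappa : {ffun V -> 'I_#|V|} | proper e kappa) \prod_v - z ^+ kappa v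
  = \sum_(J : {set V * V} | J \subset edges) (-1) ^+ #|J| *
      \sum_(kappa | eqs J kappa) \prod_v - z ^+ kappa v.
  rewrite big_mkcond /=; under [RHS]eq_bigr do rewrite big_distrr big_mkcond.
  rewrite exchange_big; apply: eq_bigr => kappa _ /=.
  transitivity ((proper e kappa)%:R * \prod_v - z ^+ kappa v).
    by case: ifP; rewrite ?mul1r ?mul0r.
  rewrite proper_expand big_distrl; apply: eq_bigr => J _ /=.
  by rewrite -/(eqs J kappa); case: ifP; rewrite ?mulr1 ?mulr0 ?mul0r.
rewrite (bigD1 edges) //= [X in _ + X]big1 ?addr0 => [|J /andP[J_e ne_J]]; last first.
  by rewrite eqs0 ?mulr0 // properEneq ne_J.
rewrite mulf_neq0 ?expf_neq0 ?oppr_eq0 ?oner_eq0 //.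
pose cst (i : 'I_#|V|) : {ffun V -> 'I_#|V|} := [ffun=> i].
have [v0 _] := card_gt0P V_gt0.
rewrite (reindex cst) /=; last first.
  exists (fun kappa => kappa v0) => [i _|kappa eq_k]; first by rewrite ffunE.
  apply/ffunP => v; rewrite ffunE; apply: connect_const => x y exy.
  move/forall_inP: eq_k => eq_k; have := mem_edges exy.
  case: ((x, y) \in edges) (eq_k (x, y)) => [/(_ isT)/eqP //|_ /= /eq_k/eqP/= //].
rewrite (eq_bigl predT) => [|i]; last by apply/forall_inP => u _; rewrite !ffunE.
rewrite (eq_bigr (fun=> (-1) ^+ #|V|)) => [|i _].
  rewrite sumr_const card_ord -mulr_natl mulf_neq0 ?pnatr_eq0 -?lt0n //.
  by rewrite expf_neq0 ?oppr_eq0 ?oner_eq0.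
under eq_bigr do rewrite ffunE.
rewrite prodr_const [LHS]exprNn -exprM mulnC exprM.
by rewrite [z ^+ _](prim_expr_order prim_z) expr1n mulr1.
Qed.

End RootColourings.

Section TwoRootBlocks.

Variables (a b : nat) (za zb : algC).
Hypotheses (prim_za : a.-primitive_root za) (prim_zb : b.-primitive_root zb).

Definition in_right (i : 'I_(a + b)) : bool :=
  if split i is inr _ then true else false.

Definition block_root (i : 'I_(a + b)) : algC :=
  match split i with inl j => - za ^+ j | inr j => - zb ^+ j end.

(** The polynomial indeterminate is the variable t that records how many vertices
    are coloured in the second block. *)
Definition block_var (i : 'I_(a + b)) : {poly algC} :=
  (block_root i)%:P * 'X ^+ in_right i.

Definition block_rot (i : 'I_(a + b)) : 'I_(a + b) :=
  match split i with inl j => lshift b (ordS j) | inr j => rshift a (ordS j) end.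

Lemma block_rot_inj : injective block_rot.
Proof.
move=> i i'; rewrite /block_rot -[i]splitK -[i']splitK.
case: (split i) => j; case: (split i') => j' /=.
- by rewrite !(unsplitK (inl _)) => /lshift_inj/(can_inj (@ordSK _)) ->.
- by rewrite (unsplitK (inl _)) (unsplitK (inr _)) => /eqP; rewrite eq_lrshift.
- by rewrite (unsplitK (inl _)) (unsplitK (inr _)) => /eqP; rewrite eq_rlshift.
- by rewrite !(unsplitK (inr _)) => /rshift_inj/(can_inj (@ordSK _)) ->.
Qed.

Lemma in_right_rot i : in_right (block_rot i) = in_right i.
Proof.
rewrite /in_right /block_rot; case: (split i) => j.
  by rewrite (unsplitK (inl _)).
by rewrite (unsplitK (inr _)).
Qed.

Lemma block_root_rot i :
  block_root (block_rot i) = (if in_right i then zb else za) * block_root i.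
Proof.
rewrite /in_right /block_root /block_rot; case: (split i) => j.
  by rewrite (unsplitK (inl _)) /= mulrN -exprS prim_expr_mod.
by rewrite (unsplitK (inr _)) /= mulrN -exprS prim_expr_mod.
Qed.

Section Vanishing.

Variables (V : finType) (e : rel V).
Hypotheses (tree_e : is_tree e) (card_V : #|V| = (a + b)%N).
Hypothesis no_split : forall x y, e x y -> #|branch e x y| != b.

Definition same_side (B : {set V}) : rel V :=
  [rel u v | e u v && ((u \in B) == (v \in B))].

Lemma same_sideE B u v :
  same_side B u v = e u v && ((u \in B) == (v \in B)).
Proof. by []. Qed.

Lemma same_side_mem B u v :
  connect (same_side B) u v -> (v \in B) = (u \in B).
Proof.
move=> /connectP[s + ->]; elim: s u => //= w s IHs u /andP[/andP[_ /eqP ->]].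
exact: IHs.
Qed.

Lemma same_side_avoid B u v w : connect (same_side B) u v ->
  (w \in B) != (u \in B) -> connect (avoid e w) u v.
Proof.
move=> /connectP[s + ->]; elim: s u => [|t s IHs] u /=; first by rewrite connect0.
case/andP=> /andP[eut /eqP Eut] path_s ne_wu.
apply: connect_trans (IHs t path_s _); last by rewrite -Eut.
apply: connect1; rewrite avoidE eut /=.
by apply/andP; split; apply: contraNneq ne_wu => <-; rewrite ?Eut.
Qed.

(** If B and its complement were both connected, an edge xy joining them would
    have branch B, of size b.  So one of the two has a component C that is not
    everything. *)
Lemma small_component (B : {set V}) : #|B| = b ->
  exists2 C : {set V}, C != set0 &
    [/\ C \proper B \/ C \proper ~: B
      & forall u v, e u v -> u \in C -> v \notin C -> (u \in B) != (v \in B)].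
Proof.
move=> card_B.
have card_CB : #|~: B| = a by have := cardsC B; lia.
have a_gt0 := prim_order_gt0 prim_za; have b_gt0 := prim_order_gt0 prim_zb.
have [/existsP[u /existsP[v /andP[same_uv nuv]]]|] := boolP
  [exists u, exists v, ((u \in B) == (v \in B)) && ~~ connect (same_side B) u v].
  pose C := [set w | connect (same_side B) u w].
  exists C; first by apply/set0Pn; exists u; rewrite inE connect0.
  split=> [|w t ewt]; last first.
    rewrite !inE => cuw; apply: contra => same_wt.
    by apply: connect_trans cuw (connect1 _); rewrite same_sideE ewt.
  have [uB|uB] := boolP (u \in B); [left|right]; apply/properP; split.
  - by apply/subsetP => w; rewrite inE => /same_side_mem ->.
  - by exists v; rewrite ?inE // -(eqP same_uv).
  - by apply/subsetP => w; rewrite !inE => /same_side_mem ->.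
  - by exists v; rewrite !inE -?(eqP same_uv).
rewrite negb_exists => /forallP conn_B.
have conn u v : (u \in B) = (v \in B) -> connect (same_side B) u v.
  move=> same_uv; move: (conn_B u); rewrite negb_exists => /forallP/(_ v).
  by rewrite same_uv eqxx negbK.
have [y0 y0B] : exists y, y \in B by apply/card_gt0P; rewrite card_B.
have [x0 x0B] : exists x, x \in ~: B by apply/card_gt0P; rewrite card_CB.
have [/existsP[x /existsP[y /and3P[exy xB yB]]]|no_edge] := boolP
  [exists x, exists y, [&& e x y, x \notin B & y \in B]].
  case/eqP: (no_split exy); rewrite -card_B; apply: eq_card => v.
  have [vB|vB] := boolP (v \in B).
    rewrite inE; apply: (@same_side_avoid B); first by apply: conn; rewrite yB.
    by rewrite yB (negbTE xB).
  apply/negbTE; rewrite -in_setC -branchC // inE.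
  apply: (@same_side_avoid B); first by apply: conn; rewrite (negbTE xB) (negbTE vB).
  by rewrite yB (negbTE xB).
have edge_B x y : e x y -> (x \in B) = (y \in B).
  move=> exy; have no_edge' u v : e u v -> v \in B -> u \in B.
    move=> euv vB; apply: contraNT no_edge => uB.
    by apply/existsP; exists u; apply/existsP; exists v; apply/and3P.
  by apply/idP/idP; apply: no_edge'; rewrite // (tree_sym tree_e).
have := connect_const tree_e edge_B x0 y0.
by rewrite y0B => x0B'; rewrite inE x0B' in x0B.
Qed.

(** Fix the set B of vertices coloured in the second block.  Rotating the colours
    within their blocks on the component C of the previous lemma keeps a
    colouring proper, since the edges that leave C join colours of different
    blocks, and multiplies its weight by the power #|C| of a primitive root of
    unity of order greater than #|C|. *)
Lemma chromatic_blocks_coef0 :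
  (\sum_(kappa : {ffun V -> 'I_(a + b)} | proper e kappa)
     \prod_v block_var (kappa v))`_b = 0.
Proof.
pose right_of (kappa : {ffun V -> 'I_(a + b)}) := [set v | in_right (kappa v)].
have coef_prod (kappa : {ffun V -> _}) : (\prod_v block_var (kappa v))`_b
    = \prod_v block_root (kappa v) * (b == #|right_of kappa|)%:R.
  rewrite big_split /= -(rmorph_prod (@polyC _)) -expr_sum coefCM coefXn.
  congr (_ * (b == _)%:R); rewrite card_sum_mem.
  by apply: eq_bigr => v _; rewrite inE.
rewrite coef_sum (partition_big right_of predT) //= big1 // => B _.
under eq_bigr do rewrite coef_prod.
have [card_B|ne_B] := eqVneq #|B| b; last first.
  by apply: big1 => kappa /andP[_ /eqP ->]; rewrite eq_sym (negbTE ne_B) mulr0.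
have [C /set0Pn[v0 v0C] [C_side C_edge]] := small_component card_B.
have a_gt0 := prim_order_gt0 prim_za; have b_gt0 := prim_order_gt0 prim_zb.
have C_gt0 : (0 < #|C|)%N by apply/card_gt0P; exists v0.
pose z := if v0 \in B then zb else za.
have C_B v : v \in C -> (v \in B) = (v0 \in B).
  case: C_side => /properP[/subsetP sub _] vC; first by rewrite !sub.
  by move: (sub v vC) (sub v0 v0C); rewrite !inE => /negbTE-> /negbTE->.
have right_recolour kappa : right_of (recolour block_rot C kappa) = right_of kappa.
  by apply/setP => v; rewrite !inE ffunE; case: ifP => // _; rewrite in_right_rot.
apply: (sum_eq0_shift (h := recolour block_rot C) (z := z ^+ #|C|)).
- exact/recolour_inj/block_rot_inj.
- move=> kappa; rewrite right_recolour; case: eqP => [EB|_]; rewrite ?andbF ?andbT //.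
  apply: eq_forallb => u; apply: eq_forallb => v.
  have [euv /=|//] := boolP (e u v); rewrite !ffunE.
  have sideP w : in_right (kappa w) = (w \in B) by rewrite -EB inE.
  have [uC|uC] := boolP (u \in C); have [vC|vC] := boolP (v \in C) => //.
  + by rewrite (inj_eq block_rot_inj).
  + have := C_edge u v euv uC vC; rewrite -!sideP => ne_uv.
    have -> : block_rot (kappa u) != kappa v.
      by apply: contraNneq ne_uv => <-; rewrite in_right_rot.
    by apply/esym; apply: contraNneq ne_uv => ->.
  + have := C_edge v u; rewrite (tree_sym tree_e) => /(_ euv vC uC).
    rewrite -!sideP => ne_uv.
    have -> : kappa u != block_rot (kappa v).
      by apply: contraNneq ne_uv => ->; rewrite in_right_rot.
    by apply/esym; apply: contraNneq ne_uv => ->.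
- move=> kappa /andP[_ /eqP EB]; rewrite right_recolour mulrA; congr (_ * _).
  apply: (prod_recolour (w := block_root)) => v vC; rewrite block_root_rot /z.
  by rewrite -(C_B v vC) -EB inE.
- rewrite /z; case: C_side => ltC; have := proper_card ltC.
    have -> : v0 \in B by case/properP: ltC => /subsetP/(_ v0 v0C).
    by rewrite card_B => lt_Cb; apply: (prim_expr_neq1 prim_zb); rewrite C_gt0.
  have /negbTE -> : v0 \notin B by case/properP: ltC => /subsetP/(_ v0 v0C); rewrite inE.
  have -> : #|~: B| = a by have := cardsC B; lia.
  by move=> lt_Ca; apply: (prim_expr_neq1 prim_za); rewrite C_gt0.
Qed.

End Vanishing.
End TwoRootBlocks.

(** * Elementary symmetric functions at roots of unity *)

Lemma sumn_ge (s : seq nat) c : {in s, forall k, (c <= k)%N} -> (c * size s <= sumn s)%N.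
Proof.
elim: s => [|k s IHs] s_ge /=; first by rewrite muln0.
rewrite mulnS leq_add ?s_ge ?mem_head // IHs // => j js.
by rewrite s_ge // inE js orbT.
Qed.

Lemma field_prod_sub_prim_root (K : fieldType) (n : nat) (z Y t : K) :
  n.-primitive_root z -> \prod_(i < n) (Y - z ^+ i * t) = Y ^+ n - t ^+ n.
Proof.
move=> prim_z; have n_gt0 := prim_order_gt0 prim_z.
have [->|t_neq0] := eqVneq t 0.
  under eq_bigr do rewrite mulr0 subr0.
  by rewrite prodr_const card_ord expr0n gtn_eqF // subr0.
transitivity (t ^+ n * ('X^n - 1).[Y / t]).
  rewrite -(factor_Xn_sub_1 prim_z) big_mkord horner_prod -[X in t ^+ X](card_ord n).
  rewrite -prodr_const -big_split /=; apply: eq_bigr => i _.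
  by rewrite !hornerE mulrBr mulrCA divff // mulr1 [t * _]mulrC.
by rewrite !hornerE mulrBr mulr1 expr_div_n mulrC divfK // expf_neq0.
Qed.

(** The variable t makes the values of the e_k live in a polynomial ring, which is
    not a field; the factorisation descends from its fraction field. *)
Lemma prod_sub_prim_root (R : idomainType) (phi : {rmorphism algC -> R})
    (n : nat) (z : algC) (Y t : R) : n.-primitive_root z ->
  \prod_(i < n) (Y - phi z ^+ i * t) = Y ^+ n - t ^+ n.
Proof.
move=> prim_z; apply/eqP; rewrite -tofrac_eq rmorph_prod rmorphB !rmorphXn /=.
rewrite -(@field_prod_sub_prim_root _ n (tofrac (phi z))).
  by apply/eqP/eq_bigr => i _; rewrite rmorphB rmorphM rmorphXn.
by rewrite (fmorph_primitive_root (@tofrac R \o phi)).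
Qed.

Section RootValues.

Variables (n : nat) (z : algC).
Hypothesis prim_z : n.-primitive_root z.
Local Notation ev := (series_eval (@ratr algC) (fun i : 'I_n => - z ^+ i)).

Lemma esym_root k : (0 < k <= n)%N -> ev k (elem_sym k) = - (k == n)%:R.
Proof.
move=> /andP[k_gt0 le_kn]; rewrite series_eval_esym_coef //.
under eq_bigr do rewrite polyCN.
rewrite -(big_mkord predT (fun i => 'X - (z ^+ i)%:P)) factor_Xn_sub_1 //.
rewrite coefB coefXn coef1.
have -> : (n - k == n)%N = false by lia.
have -> : (n - k == 0)%N = (k == n) by lia.
by rewrite sub0r.
Qed.

Lemma esym_part_root la : is_partition la -> sumn la = n -> la != [:: n] ->
  ev n (esym_part la) = 0.
Proof.
have n_gt0 := prim_order_gt0 prim_z.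
move=> /andP[_ part_la] sum_la ne_la; rewrite -[X in series_eval _ _ X]sum_la.
rewrite series_eval_esym_part.
case: la part_la sum_la ne_la => [|k la] /=; first by lia.
rewrite inE negb_or eq_sym -lt0n big_cons => /andP[k_gt0 part_la] sum_la ne_la.
rewrite esym_root; last by lia.
have [Ek|_] := eqVneq k n; last by rewrite oppr0 mul0r.
case: la part_la sum_la ne_la => [|k' la] /=; first by rewrite Ek eqxx.
by rewrite inE negb_or; lia.
Qed.

End RootValues.

Section BlockValues.

Variables (a b : nat) (za zb : algC).
Hypotheses (prim_za : a.-primitive_root za) (prim_zb : b.-primitive_root zb).
Hypothesis le_ba : (b <= a)%N.

Local Notation rat_poly := ((@polyC algC) \o (@ratr algC)).
Local Notation ev := (series_eval rat_poly (@block_var a b za zb)).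

Lemma prod_block_var :
  \prod_i ('X + (@block_var a b za zb i)%:P)
    = ('X^a - 1) * ('X^b - ('X^b)%:P) :> {poly {poly algC}}.
Proof.
pose phi : {rmorphism algC -> {poly {poly algC}}} := (@polyC _) \o (@polyC _).
rewrite big_split_ord; congr (_ * _).
  rewrite -[in RHS](expr1n _ a) -(prod_sub_prim_root phi _ _ prim_za).
  apply: eq_bigr => i _; rewrite /block_var /block_root /in_right (unsplitK (inl _)).
  by rewrite !mulr1 /phi /= !polyCN !rmorphXn.
rewrite [('X^b)%:P]rmorphXn -(prod_sub_prim_root phi _ _ prim_zb).
apply: eq_bigr => i _; rewrite /block_var /block_root /in_right (unsplitK (inr _)).
by rewrite expr1 /phi /= !polyCN mulNr polyCN rmorphM !rmorphXn.
Qed.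

(** The coefficients of (X^a - 1) (X^b - t^b). *)
Lemma esym_block k : (0 < k <= a + b)%N ->
  ev k (elem_sym k) = (k == a + b)%N%:R * 'X^b - ((k == a)%:R + (k == b)%:R * 'X^b).
Proof.
move=> /andP[k_gt0 le_k]; rewrite series_eval_esym_coef // prod_block_var.
have a_gt0 := prim_order_gt0 prim_za; have b_gt0 := prim_order_gt0 prim_zb.
rewrite mulrBl mul1r mulrBr -exprD.
rewrite !coefB coefMC !coefXn coefC.
have -> : (a + b - k == a + b)%N = false by lia.
have -> : (a + b - k == a)%N = (k == b) by lia.
have -> : (a + b - k == b)%N = (k == a) by lia.
have -> : (a + b - k == 0)%N = (k == a + b)%N by lia.
by rewrite mulr0n; case: (k == a + b)%N; rewrite ?mul1r ?mul0r ?mulr0n; ring.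
Qed.

Lemma block_coef_top : (ev (a + b) (esym_part [:: a + b]%N))`_b = 1.
Proof.
have a_gt0 := prim_order_gt0 prim_za; have b_gt0 := prim_order_gt0 prim_zb.
have -> : ev (a + b) (esym_part [:: a + b]%N)
    = ev (sumn [:: a + b]%N) (esym_part [:: a + b]%N).
  by rewrite /= addn0.
rewrite series_eval_esym_part big_seq1 esym_block; last by lia.
rewrite eqxx mul1r (_ : (a + b == a)%N = false); last by lia.
rewrite (_ : (a + b == b)%N = false); last by lia.
by rewrite mul0r addr0 subr0 coefXn eqxx.
Qed.

(** Only parts equal to a, b or a + b give a nonzero factor.  The factors for a and
    b have nonpositive coefficients, so two of them have a nonnegative product.
    If three or more parts are all equal to a or b, then b <= a forces every part
    to be b and b <> a, and the product is plus or minus t^(b m) with m >= 3,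
    which does not contribute to t^b. *)
Lemma block_coef_ge0 la : is_partition la -> sumn la = (a + b)%N ->
  0 <= (ev (a + b) (esym_part la))`_b.
Proof.
have a_gt0 := prim_order_gt0 prim_za; have b_gt0 := prim_order_gt0 prim_zb.
move=> /andP[_ part_la] sum_la; rewrite -[X in series_eval _ _ X]sum_la.
have [size_la|size_la] := leqP (size la) 2.
  case: la part_la sum_la size_la => [|k1 [|k2 [|//]]] /=; first by lia.
    by rewrite addn0 => _ -> _; rewrite block_coef_top.
  rewrite !inE !negb_or addn0 => /andP[k1_gt0 k2_gt0] sum_k _.
  have -> : (k1 + k2 = sumn [:: k1; k2])%N by rewrite /= addn0.
  rewrite series_eval_esym_part big_cons big_seq1.
  pose p (k : nat) : {poly algC} := (k == a)%:R + (k == b)%:R * 'X^b.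
  have pE k : (0 < k < a + b)%N -> ev k (elem_sym k) = - p k.
    move=> k_lt; rewrite esym_block; last by lia.
    by rewrite (_ : (k == a + b)%N = false) ?mul0r ?sub0r //; lia.
  have p_ge0 k i : 0 <= (p k)`_i.
    rewrite /p; case: (k == a); case: (k == b);
    by rewrite ?mul1r ?mul0r ?mulr0n coefD ?coef0 ?coef1 ?coefXn ?addr_ge0 ?ler0n.
  rewrite pE ?pE ?mulrNN; try lia.
  by rewrite coefM sumr_ge0 // => i _; rewrite mulr_ge0.
rewrite series_eval_esym_part.
have sum_rem k : k \in la -> (k + sumn (rem k la) = a + b)%N.
  by move=> /perm_to_rem/perm_sumn /= <-.
have la_gt0 k : k \in la -> (0 < k)%N.
  by rewrite lt0n; apply: contraTneq => ->.
have [all_ab|] := boolP (all (fun k => (k == a) || (k == b)) la); last first.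
  case/allPn=> k k_la /norP[/negbTE ne_ka /negbTE ne_kb].
  rewrite (big_rem k) //= esym_block; last by rewrite la_gt0 //= -(sum_rem k k_la) leq_addr.
  have -> : (k == a + b)%N = false.
    have : (0 < sumn (rem k la))%N; last by have := sum_rem k k_la; lia.
    apply: leq_trans (@sumn_ge (rem k la) 1 _).
      by rewrite mul1n size_rem //; case: (size la) size_la => [|[]].
    by move=> j /mem_rem/la_gt0.
  by rewrite ne_ka ne_kb !mul0r addr0 subr0 mul0r coef0.
have la_ge k : k \in la -> (b <= k)%N by move/(allP all_ab); lia.
have la_b k : k \in la -> (k != a) && (k == b).
  move=> k_la; have : (b * size (rem k la) <= sumn (rem k la))%N.
    by apply: sumn_ge => j /mem_rem/la_ge.
  have size_rem_ge : (b * 2 <= b * size (rem k la))%N.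
    by rewrite leq_mul2l size_rem //; apply/orP; right; case: (size la) size_la => [|[|[]]].
  by have := sum_rem k k_la; have := allP all_ab k k_la; lia.
have -> : \prod_(k <- la) ev k (elem_sym k) = (- 'X^b) ^+ size la.
  rewrite -(count_predT la) -iter_mulr_1 -big_const_seq.
  apply: eq_big_seq => k /la_b/andP[ne_ka /eqP Ek].
  rewrite esym_block; last by lia.
  rewrite (negbTE ne_ka) Ek eqxx (_ : (b == a + b)%N = false); last by lia.
  by rewrite mul0r mul1r sub0r add0r.
rewrite exprNn -exprM -signr_odd mulr_sign.
have ne_b : (b == b * size la)%N = false.
  by rewrite -[X in (X == _)%N]muln1 eqn_pmul2l //; lia.
by case: odd; rewrite ?coefN coefXn ne_b ?oppr0.
Qed.

End BlockValues.

(** * Edges of an e-positive tree *)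

(** The evaluation at the n-th roots of unity shows c_n <> 0.  Without the desired
    edge, the evaluation at the two blocks gives a vanishing sum of nonnegative
    terms in which the term of e_n is c_n. *)
Lemma e_positive_branch (V : finType) (e : rel V) (a b : nat) :
    is_tree e -> e_positive e -> #|V| = (a + b)%N -> (0 < b <= a)%N ->
  exists x y, e x y /\ #|branch e x y| = b.
Proof.
move=> tree_e [s [c [uniq_s part_s chromE c_ge0]]] card_V /andP[b_gt0 le_ba].
have V_gt0 : (0 < #|V|)%N by rewrite card_V; lia.
have a_gt0 : (0 < a)%N by lia.
have [z prim_z] := C_prim_root_exists V_gt0.
have [za prim_za] := C_prim_root_exists a_gt0.
have [zb prim_zb] := C_prim_root_exists b_gt0.
have eval_chrom (R : comNzRingType) (phi : {rmorphism rat -> R}) N (x : 'I_N -> R) :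
  \sum_(kappa : {ffun V -> 'I_N} | proper e kappa) \prod_v x (kappa v)
   = \sum_(la <- s | sumn la == #|V|) phi (c la) * series_eval phi x #|V| (esym_part la).
  rewrite -(series_eval_chromatic phi) (eq_series_eval _ _ _ chromE) series_eval_sum.
  rewrite [RHS]big_mkcond; apply: eq_bigr => la _; case: eqP => // /eqP ne_la.
  rewrite (series_eval_homogeneous _ _ (@homogeneous_esym_part la)) ?mulr0 //.
  by rewrite eq_sym.
have [n_in cn_neq0] : [:: #|V|] \in s /\ c [:: #|V|] != 0.
  have := chromatic_root_neq0 tree_e prim_z.
  rewrite (eval_chrom _ (@ratr algC) _ (fun i : 'I__ => - z ^+ i)) => sum_neq0.
  split; apply: contraNT sum_neq0.
    move=> n_notin; apply/eqP; rewrite big_seq_cond big1 // => la /andP[la_s /eqP sum_la].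
    rewrite (esym_part_root prim_z) ?mulr0 //; first exact: (allP part_s).
    by apply: contraNneq n_notin => <-.
  rewrite negbK => /eqP cn0; apply/eqP.
  rewrite big_seq_cond big1 // => la /andP[la_s /eqP sum_la].
  have [->|ne_la] := eqVneq la [:: #|V|]; first by rewrite cn0 rmorph0 mul0r.
  by rewrite (esym_part_root prim_z) ?mulr0 //; apply: (allP part_s).
have [/existsP[x /existsP[y /andP[exy /eqP]]]|] := boolP
  [exists x, exists y, e x y && (#|branch e x y| == b)]; first by exists x, y.
rewrite negb_exists => /forallP no_split.
have {}no_split x y : e x y -> #|branch e x y| != b.
  by move=> exy; move: (no_split x); rewrite negb_exists => /forallP/(_ y); rewrite exy.
pose phi : {rmorphism rat -> {poly algC}} := @polyC algC \o @ratr algC.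
have := chromatic_blocks_coef0 prim_za prim_zb tree_e card_V no_split.
rewrite (eval_chrom _ phi) card_V coef_sum => /eqP.
rewrite big_seq_cond psumr_eq0 => [/allP/(_ [:: #|V|] n_in)|la /andP[la_s /eqP sum_la]].
  rewrite n_in /= addn0 card_V eqxx /= coefCM block_coef_top // mulr1 fmorph_eq0.
  by rewrite -card_V (negbTE cn_neq0).
by rewrite coefCM mulr_ge0 ?ler0q ?c_ge0 // block_coef_ge0 //; apply: (allP part_s).
Qed.

(** * The bound *)

(* The case n = 2 is excluded: for the single edge, X_G = 2 e_2 is e-positive,
   the bound equals 1, and there is no acyclic orientation with 2 sinks. *)
Theorem theorem3p4 (V : finType) (e : rel V) (n l : nat)
    (tree_e : is_tree e) (card_V : #|V| = n) (card_leaves : #|leaves e| = l)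
    (n_neq2 : n <> 2%N) (e_pos : e_positive e) :
  \sum_(uphalf n <= k < n.-1) k%:R * (n%:R - k%:R)
    + (2 * l%:R - n%:R) * (n%:R - 1) / 2
  <= #|acyclic_orientations_with_sinks e 2|%:R :> rat.
Proof.
have V_gt0 : (0 < #|V|)%N by case: tree_e.
set t := #|acyclic_orientations_with_sinks e 2|.
have [n_gt2|n_le2] := ltnP 2 n; last first.
  have n1 : n = 1%N by lia.
  by rewrite n1 big_geq // subrr mulr0 mul0r add0r ler0n.
have splits k : (uphalf #|V| <= k < #|V|.-1)%N ->
    exists x y, e x y /\ #|branch e x y| = k.
  (* e_positive_branch finds the smaller branch; the arc is reversed. *)
  move=> k_range; have := @e_positive_branch V e k (#|V| - k) tree_e e_pos.
  case=> [||y [x [eyx card_b]]]; try lia.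
  exists x, y; have exy : e x y by rewrite (tree_sym tree_e).
  by split=> //; have := card_branchC tree_e exy; lia.
have V_gt2 : (2 < #|V|)%N by rewrite card_V.
have := wiener_ge tree_e V_gt2 splits.
rewrite -(wiener_sum tree_e); have := card_separates_le tree_e.
rewrite -/t card_leaves card_V.
set T := #|_|; set S := (\sum_(_ <= k < _) _)%N => le_T le_S.
have -> : \sum_(uphalf n <= k < n.-1) k%:R * (n%:R - k%:R) = S%:R :> rat.
  rewrite /S natr_sum [LHS]big_nat_cond [RHS]big_nat_cond; apply: eq_bigr => k /andP[k_n _].
  by rewrite natrM natrB //; lia.
have le_St : (2 * S + 2 * (l * n.-1) <= 2 * t + n * n.-1)%N by lia.
have {}le_St : (2 * S + 2 * (l * n.-1))%N%:R <= (2 * t + n * n.-1)%N%:R :> rat.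
  by rewrite ler_nat.
have pred_n : n.-1%:R = n%:R - 1 :> rat by rewrite -subn1 natrB //; lia.
by move: le_St; rewrite !natrD !natrM pred_n; lra.
Qed.
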